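(* In the setting of the context, assume: (i) $\kappa$ is measurable, locally bounded, nonnegative and $\kappa(x)\to\infty$ as $|x|\to\infty$; (ii) the eigenfunction $\varphi_0$ of $L^\kappa$ with eigenvalue $\lambda_0^\kappa$ satisfies $\kappa\varphi_0\in\mathcal H$; (iii) $M\ge\lambda_0^\kappa$; (iv) $\delta>0$ is such that $\widehat\lambda_1^M>\lambda_0^\kappa+\delta$. Let $\widehat\varphi_0$ be the normalized eigenfunction of $\widehat L^M$ with eigenvalue $\inf\sigma(\widehat L^M)$, chosen such that $\langle\varphi_0,\widehat\varphi_0\rangle\ge0$. Then $$\|\widehat\varphi_0-\varphi_0\|_2\le\frac{\sqrt2}{\sqrt{1+\langle\varphi_0,\widehat\varphi_0\rangle}}\cdot\frac{\|H_ME_0\|}{\delta}\le\frac{\sqrt2\,\|H_ME_0\|}{\delta},$$ where $E_0:\mathbb R\to\mathcal H$, $E_0\theta=\theta\varphi_0$, and $\|H_ME_0\|$ is the operator norm.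
   Context: Let $A:\mathbb R^d\to\mathbb R$ be infinitely differentiable such that $dX_t=\nabla A(X_t)\,dt+dW_t$ ($W$ standard $d$-dimensional Brownian motion) has a unique non-explosive weak solution. Let $\Gamma(dy)=\exp(2A(y))\,dy$ and let $\mathcal H=\mathcal L^2(\mathbb R^d,\Gamma)$ (real-valued), with inner product $\langle\cdot,\cdot\rangle$ and norm $\|\cdot\|_2$; $\mathsf S(\mathcal H)$ is its unit sphere. For a measurable locally bounded $k:\mathbb R^d\to[0,\infty)$ let $L^k=-\frac12\Delta-\nabla A\cdot\nabla+k$, the self-adjoint operator on $\mathcal H$ with domain $\mathcal D(L^k)=\{f\in\mathcal H:-\frac12\Delta f-\nabla A\cdot\nabla f+kf\in\mathcal H\}$ (weak derivatives). For the killing rate $\kappa$, $\lambda_0^\kappa:=\inf\sigma(L^\kappa)$ and $\varphi_0\in\mathsf S(\mathcal H)$ is the strictly positive eigenfunction of $L^\kappa$ with eigenvalue $\lambda_0^\kappa$ (which exists under (i)). For $M\ge0$ put $\kappa_M=\kappa\wedge M$ and $\widehat L^M:=L^{\kappa_M}$. Under (i)–(iii), $\inf\sigma(\widehat L^M)$ is an eigenvalue of $\widehat L^M$ with a strictly positive eigenfunction, and the corresponding eigenspace is one-dimensional. Define $$\widehat\lambda_1^M:=\sup_{\mathbb V}\inf_{f\in\mathbb V^\perp\cap\mathsf S(\mathcal H)\cap\mathcal D(\widehat L^M)}\langle f,\widehat L^Mf\rangle,$$ with the supremum over all one-dimensional linear subspaces $\mathbb V$ of $\mathcal H$. $H_M$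 is the multiplication operator $H_Mf=-(\kappa-M)_+f$ with domain $\{f\in\mathcal H:(\kappa-M)_+f\in\mathcal H\}$, where $g_+=\max\{g,0\}$. *)

(* Defs.v *)
From HB Require Import structures.
From mathcomp Require Import all_boot all_order all_algebra.
From mathcomp Require Import all_classical all_reals all_analysis.
From mathcomp Require Import measurable_realfun.

Set Implicit Arguments.
Unset Strict Implicit.
Unset Printing Implicit Defensive.

Import Order.TTheory GRing.Theory Num.Theory.
Import numFieldNormedType.Exports.

Local Open Scope classical_set_scope.
Local Open Scope ring_scope.

Definition rV_display : measure_display. Proof. exact. Qed.

(* 'rV[R]_n is equipped with the product (= Borel) sigma-algebra. *)
Section measurable_rV.
Context {R : realType}.
Variable n : nat.

Let coord (i : 'I_n) (x : 'rV[R]_n) : R := x ord0 i.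

Let rV_set0 : g_sigma_preimage coord set0.
Proof. exact: sigma_algebra0. Qed.

Let rV_setC B : g_sigma_preimage coord B -> g_sigma_preimage coord (~` B).
Proof. exact: sigma_algebraC. Qed.

Let rV_bigcup (F : (set 'rV[R]_n)^nat) :
  (forall i, g_sigma_preimage coord (F i)) ->
  g_sigma_preimage coord (\bigcup_i (F i)).
Proof. exact: sigma_algebra_bigcup. Qed.

HB.instance Definition _ := @isMeasurable.Build rV_display
  'rV[R]_n (g_sigma_preimage coord) rV_set0 rV_setC rV_bigcup.

Lemma measurable_coord (i : 'I_n) :
  measurable_fun [set: 'rV[R]_n] (fun x : 'rV[R]_n => x ord0 i).
Proof.
move=> _ Y mY; rewrite setTI; apply: sub_sigma_algebra => /=.
rewrite -bigcup_seq/=; exists i => /=; first by rewrite mem_index_enum.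
by exists Y => //; rewrite setTI.
Qed.

Lemma measurable_fun_rVP d (T : measurableType d) (f : T -> 'rV[R]_n) :
  (forall i, measurable_fun [set: T] (fun t => f t ord0 i)) ->
  measurable_fun [set: T] f.
Proof.
move=> mf.
apply: (@measurability _ _ _ _ setT f) => //.
move=> _ [B + <-].
rewrite -bigcup_seq/= => -[i _ [Y mY <-]].
rewrite [X in setT `&` _ @^-1` X]setTI.
exact: (mf i).
Qed.

End measurable_rV.

Section lebesgue_rV.
Context {R : realType}.

Definition consr n (tx : R * 'rV[R]_n) : 'rV[R]_n.+1 :=
  \row_(i < n.+1) oapp (fun j => tx.2 ord0 j) tx.1 (unlift ord0 i).

Definition unconsr n (x : 'rV[R]_n.+1) : R * 'rV[R]_n :=
  (x ord0 ord0, \row_(i < n) x ord0 (lift ord0 i)).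

Lemma consrK n : cancel (@consr n) (@unconsr n).
Proof.
move=> [t x]; rewrite /consr /unconsr; congr pair.
  by rewrite mxE unlift_none.
by apply/rowP => i; rewrite !mxE liftK.
Qed.

Lemma unconsrK n : cancel (@unconsr n) (@consr n).
Proof.
move=> x; apply/rowP => i; rewrite /consr mxE.
by case: unliftP => [j|] -> /=; rewrite ?mxE.
Qed.

Lemma measurable_consr n : measurable_fun [set: R * 'rV[R]_n] (@consr n).
Proof.
apply: measurable_fun_rVP => i; rewrite /consr.
under eq_fun do rewrite mxE.
case: unliftP => [j|] _ /=; last exact: measurable_fst.
exact: (measurableT_comp (measurable_coord j) measurable_snd).
Qed.

Lemma measurable_unconsr n : measurable_fun [set: 'rV[R]_n.+1] (@unconsr n).
Proof.
apply/measurable_fun_pairP; split; first exact: measurable_coord.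
apply: measurable_fun_rVP => i /=.
under eq_fun do rewrite mxE.
exact: measurable_coord.
Qed.

Section step.
Local Open Scope ereal_scope.
Variables (n : nat) (m : {sigma_finite_measure set 'rV[R]_n -> \bar R}).

(* Lebesgue measure on R^(n+1) is the image of the product of Lebesgue measure
   on R with the one on R^n. *)
Definition lebesgue_cons : set 'rV[R]_n.+1 -> \bar R :=
  pushforward (@lebesgue_measure R \x m) (@consr n).

Let lebesgue_cons0 : lebesgue_cons set0 = 0.
Proof. by rewrite /lebesgue_cons /pushforward preimage_set0 measure0. Qed.

Let lebesgue_cons_ge0 A : 0 <= lebesgue_cons A.
Proof. by apply: (@measure_ge0 _ _ _ (lebesgue_measure \x m)). Qed.

Let lebesgue_cons_sigma_additive : semi_sigma_additive lebesgue_cons.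
Proof.
move=> F mF tF mUF; rewrite /lebesgue_cons /pushforward preimage_bigcup.
have mc A : measurable A -> measurable (@consr n @^-1` A).
  by move=> mA; rewrite -[X in measurable X]setTI; exact: measurable_consr.
apply: measure_semi_sigma_additive.
- by move=> k; exact: mc.
- apply/trivIsetP => /= i j _ _ ij; rewrite -preimage_setI.
  by move/trivIsetP : tF => /(_ _ _ _ _ ij) ->//; rewrite preimage_set0.
- by rewrite -preimage_bigcup; exact: mc.
Qed.

HB.instance Definition _ := isMeasure.Build _ _ _ lebesgue_cons
  lebesgue_cons0 lebesgue_cons_ge0 lebesgue_cons_sigma_additive.

Let lebesgue_cons_sigma_finite : sigma_finite setT lebesgue_cons.
Proof.
have /sigma_finiteP[F [TF ndF Foo]] := sigma_finiteT (@lebesgue_measure R).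
have /sigma_finiteP[G [TG ndG Goo]] := sigma_finiteT m.
exists (fun k => @unconsr n @^-1` (F k `*` G k)).
  rewrite -preimage_bigcup (_ : \bigcup_i _ = setT) ?preimage_setT//.
  apply/seteqP; split => // -[t x] _.
  have [k _ Fkt] : (\bigcup_k F k) t by rewrite -TF.
  have [l _ Glx] : (\bigcup_k G k) x by rewrite -TG.
  exists (maxn k l) => //; split => /=.
  - by move: t Fkt; exact/subsetPset/ndF/leq_maxl.
  - by move: x Glx; exact/subsetPset/ndG/leq_maxr.
move=> k; have [mF Fk] := Foo k; have [mG Gk] := Goo k.
have mFG : measurable (F k `*` G k) by exact: measurableX.
split; first by rewrite -[X in measurable X]setTI; exact: measurable_unconsr.
rewrite /lebesgue_cons /pushforward.
rewrite (_ : _ @^-1` _ = F k `*` G k); last first.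
  by rewrite -comp_preimage (_ : _ \o _ = id) //; apply/funext => z; exact: consrK.
by rewrite product_measure1E// lte_mul_pinfty// ge0_fin_numE.
Qed.

HB.instance Definition _ := Measure_isSigmaFinite.Build _ _ _ lebesgue_cons
  lebesgue_cons_sigma_finite.

End step.

Fixpoint lebesgue_rV n : {sigma_finite_measure set 'rV[R]_n -> \bar R} :=
  if n is n'.+1 then lebesgue_cons (lebesgue_rV n') else \d_(0 : 'rV[R]_0).

Lemma lebesgue_rV_prod n (B : 'I_n -> set R) :
  (forall i, measurable (B i)) ->
  (lebesgue_rV n [set x | forall i, B i (x ord0 i)] =
   \prod_(i < n) lebesgue_measure (B i))%E.
Proof.
elim: n B => [|n IH] B mB.
  rewrite big_ord0 /= diracE mem_set//; by case.
rewrite big_ord_recl -IH; last by [].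
rewrite /= /lebesgue_cons /pushforward -product_measure1E//.
  congr (_ _); apply/seteqP; split => -[t x] /=.
    move=> H; split => /=.
      by have := H ord0; rewrite mxE unlift_none.
    by move=> i; have := H (lift ord0 i); rewrite mxE liftK.
  move=> -[/= Bt Bx] i; rewrite mxE.
  by case: unliftP => [j|] -> /=.
  exact: mB.
rewrite (_ : (fun x : 'rV[R]_n => _) =
    \bigcap_(i in [set: 'I_n]) [set x | B (lift ord0 i) (x ord0 i)]); last first.
  by apply/seteqP; split => x /= H i; [move=> _|]; exact: H.
apply: fin_bigcap_measurable => // i _.
have := @measurable_coord R n i measurableT _ (mB (lift ord0 i)).
by rewrite setTI.
Qed.

End lebesgue_rV.

Section calculus.
Context {R : realType} {d : nat}.
Implicit Types (f g k : 'rV[R]_d -> R).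

Definition partial (i : 'I_d) f : 'rV[R]_d -> R := 'D_(delta_mx ord0 i) f.

Fixpoint class_C (n : nat) f : Prop :=
  if n is n'.+1
  then (forall x, differentiable f x) /\ (forall i, class_C n' (partial i f))
  else continuous f.

Definition smooth f := forall n, class_C n f.

Definition test_function f :=
  smooth f /\ exists2 K : set 'rV[R]_d, compact K & forall x, ~ K x -> f x = 0.

Definition locally_integrable_rV f :=
  measurable_fun [set: 'rV[R]_d] f /\
  forall K : set 'rV[R]_d, compact K ->
    (\int[lebesgue_rV d]_(x in K) `|f x|%:E < +oo)%E.

Definition weak_partial (i : 'I_d) f g :=
  [/\ locally_integrable_rV f, locally_integrable_rV g &
   forall phi, test_function phi ->
     \int[lebesgue_rV d]_x (f x * partial i phi x) =
     - \int[lebesgue_rV d]_x (g x * phi x)].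

Definition locally_bounded k :=
  forall x : 'rV[R]_d, exists C : R, \forall y \near x, `|k y| <= C.

(* The norm on 'rV[R]_d is the sup norm, equivalent to the Euclidean one. *)
Definition tends_to_infinity k :=
  forall C : R, exists r : R, forall x, r <= `|x| -> C <= k x.

End calculus.

Section langevin.
Context {R : realType} {d : nat}.

Section processes.
Context {dO : measure_display} {O : measurableType dO}.
Variable P : probability O R.
Implicit Types (F : R -> set (set O)) (X W : R -> O -> 'rV[R]_d).

Definition filtration F :=
  (forall t, 0 <= t -> sigma_algebra setT (F t) /\ F t `<=` measurable) /\
  (forall s t, 0 <= s -> s <= t -> F s `<=` F t).

Definition adapted F X :=
  forall t (B : set 'rV[R]_d), 0 <= t -> measurable B -> F t (X t @^-1` B).

Definition continuous_paths X :=
  forall w, {within [set t : R | 0 <= t], continuous (fun t => X t w)}.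

(* The last clause says at once that W t - W s is independent of F s and that
   it is N(0, (t - s) I_d) distributed (boxes are a pi-system generating the
   Borel sets); the second parameter of normal_prob is the standard
   deviation. *)
Definition brownian_motion F W :=
  [/\ {ae P, forall w, W 0 w = 0}, adapted F W, continuous_paths W &
   forall s t (E : set O) (B : 'I_d -> set R),
     0 <= s -> s < t -> F s E -> (forall i, measurable (B i)) ->
     P (E `&` [set w | forall i, B i ((W t w - W s w) ord0 i)]) =
     (P E * \prod_(i < d) normal_prob 0 (Num.sqrt (t - s)) (B i))%E].

(* Weak solution, on the whole of [0, +oo[ (hence non-explosive) and started
   at x, of dX_t = grad A (X_t) dt + dW_t; as the diffusion coefficient is
   constant no stochastic integral is needed. *)
Definition weak_solution (A : 'rV[R]_d -> R) (x : 'rV[R]_d) F W X :=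
  [/\ filtration F, brownian_motion F W, adapted F X, continuous_paths X &
   {ae P, forall w, forall t i, 0 <= t ->
     X t w ord0 i = x ord0 i
       + \int[lebesgue_measure]_(s in `[0, t]) partial i A (X s w)
       + W t w ord0 i}].

End processes.

Definition langevin_well_posed (A : 'rV[R]_d -> R) := forall x : 'rV[R]_d,
  (exists (dO : measure_display) (O : measurableType dO) (P : probability O R)
     (F : R -> set (set O)) (W X : R -> O -> 'rV[R]_d),
     weak_solution P A x F W X) /\
  (forall (d1 d2 : measure_display)
     (O1 : measurableType d1) (O2 : measurableType d2)
     (P1 : probability O1 R) (P2 : probability O2 R)
     (F1 : R -> set (set O1)) (F2 : R -> set (set O2))
     (W1 X1 : R -> O1 -> 'rV[R]_d) (W2 X2 : R -> O2 -> 'rV[R]_d),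
     weak_solution P1 A x F1 W1 X1 -> weak_solution P2 A x F2 W2 X2 ->
     forall n (t : 'I_n -> R) (B : 'I_n -> set 'rV[R]_d),
       (forall j, 0 <= t j) -> (forall j, measurable (B j)) ->
       P1 [set w | forall j, B j (X1 (t j) w)] =
       P2 [set w | forall j, B j (X2 (t j) w)]).

End langevin.

(* A is bundled as a measurable function only so that Gamma is a measure for
   every A; a smooth function is measurable. *)
Section Gamma.
Context {R : realType} {d : nat}.
Variable A : {mfun 'rV[R]_d >-> R}.
Local Open Scope ereal_scope.

Definition Gamma (B : set 'rV[R]_d) : \bar R :=
  \int[lebesgue_rV d]_(y in B) (expR (2 * A y))%:E.

Let density_ge0 y : 0 <= (expR (2 * A y))%:E.
Proof. by rewrite lee_fin expR_ge0. Qed.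

Let measurable_density :
  measurable_fun [set: 'rV[R]_d] (EFin \o (fun y => expR (2 * A y)%R)).
Proof.
apply/measurable_EFinP; apply: measurableT_comp => //.
exact: measurable_funM.
Qed.

Let Gamma0 : Gamma set0 = 0. Proof. exact: integral_set0. Qed.

Let Gamma_ge0 B : 0 <= Gamma B. Proof. exact: integral_ge0. Qed.

Let Gamma_sigma_additive : semi_sigma_additive Gamma.
Proof.
move=> F mF tF mUF; rewrite /Gamma ge0_integral_bigcup//; last first.
  exact: measurable_funTS.
by apply: is_cvg_ereal_nneg_natsum_cond => n _ _; exact: integral_ge0.
Qed.

HB.instance Definition _ := isMeasure.Build _ _ _ Gamma
  Gamma0 Gamma_ge0 Gamma_sigma_additive.

End Gamma.

Section operators.
Context {R : realType} {dT : measure_display} {T : measurableType dT}.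
Variable mu : {measure set T -> \bar R}.

(* The real Hilbert space of square integrable functions: elements are
   representatives, and equality of elements is equality mu-a.e. *)
Definition L2 := LfunType mu (lee1n 2).

Definition inner (f g : L2) : R := \int[mu]_x (f x * g x).

Definition norm2 (f : L2) : R := fine ('N[mu]_2%:E[EFin \o f])%E.

(* A possibly unbounded operator S on L2 is given by its graph: S f g means
   that f is in the domain of S and that S f = g. *)
Definition densely_defined (S : L2 -> L2 -> Prop) :=
  forall (f : L2) (e : R), 0 < e -> exists h h', S h h' /\ norm2 (f - h) < e.

Definition adjoint (S : L2 -> L2 -> Prop) (f g : L2) :=
  forall h h', S h h' -> inner f h' = inner g h.

(* sa_adjoint and sa_dense imply that sa_graph is single-valued and linear, and
   that it is compatible with a.e. equality. *)
Record selfadjoint_operator := SelfAdjoint {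
  sa_graph :> L2 -> L2 -> Prop ;
  sa_dense : densely_defined sa_graph ;
  sa_adjoint : forall f g, sa_graph f g <-> adjoint sa_graph f g }.

(* S - l is a bijection from the domain of S onto L2, with bounded inverse
   (the norm inequality contains injectivity). *)
Definition resolvent_set (S : L2 -> L2 -> Prop) : set R := [set l |
  (forall g : L2, exists f h, S f h /\ (h - l *: f : L2) = g %[ae mu]) /\
  (exists C : R, forall f h, S f h -> norm2 f <= C * norm2 (h - l *: f))].

(* The real spectrum, which is the whole spectrum for self-adjoint operators. *)
Definition spectrum (S : L2 -> L2 -> Prop) : set R := ~` resolvent_set S.

Definition spectral_bottom (S : L2 -> L2 -> Prop) : \bar R :=
  ereal_inf [set l%:E | l in spectrum S].

Definition eigenfunction (S : L2 -> L2 -> Prop) (l : R) (f : L2) :=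
  ~ (f = (0 : L2) %[ae mu]) /\ S f (l *: f).

Definition one_dimensional (V : set L2) :=
  exists2 v : L2, ~ (v = (0 : L2) %[ae mu]) &
    V = [set f : L2 | exists a : R, f = (a *: v : L2) %[ae mu]].

Definition orthogonal_complement (V : set L2) : set L2 :=
  [set f | forall h, V h -> inner f h = 0].

Definition second_variational_value (S : L2 -> L2 -> Prop) : \bar R :=
  ereal_sup [set ereal_inf
      [set r | exists f g : L2,
        [/\ orthogonal_complement V f, norm2 f = 1, S f g &
            r = (inner f g)%:E]]
    | V in one_dimensional].

Definition multiplication (m : T -> R) (f g : L2) :=
  (g : T -> R) = (fun x => m x * f x) %[ae mu].

(* For U given by its graph, from R to L2. *)
Definition operator_norm (U : R -> L2 -> Prop) : R :=
  sup [set norm2 g | g in [set g | exists2 theta : R, `|theta| <= 1 & U theta g]].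

End operators.

Section generator.
Context {R : realType} {d : nat}.
Variable A : {mfun 'rV[R]_d >-> R}.

(* Graph of the operator -1/2 Delta - grad A . grad + k whose domain is the set
   of the f in L2 such that -1/2 Delta f - grad A . grad f + k f is in L2; u i
   and w i are the weak derivatives d_i f and d_i (d_i f). *)
Definition generator (k : 'rV[R]_d -> R) (f g : L2 (Gamma A)) :=
  exists u w : 'I_d -> 'rV[R]_d -> R,
    [/\ forall i, weak_partial i f (u i),
        forall i, weak_partial i (u i) (w i) &
        (g : 'rV[R]_d -> R) =
        (fun x => - 2^-1 * (\sum_(i < d) w i x)
                  - (\sum_(i < d) partial i A x * u i x) + k x * f x)
        %[ae Gamma A]].

End generator.

(* Main.v *)
Require Import Defs.
From HB Require Import structures.
From mathcomp Require Import all_boot all_order all_algebra.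
From mathcomp Require Import all_classical all_reals all_analysis.
From mathcomp Require Import measurable_realfun.
From mathcomp Require Import ring lra.

Import Order.TTheory GRing.Theory Num.Theory.
Import numFieldNormedType.Exports.

Local Open Scope classical_set_scope.
Local Open Scope ring_scope.

(** The proof is a Davis-Kahan argument for the truncated operator LM, with
    phi0 as an approximate eigenvector.  Write h for HM phi0 and c for
    <phi0, hphi0>.  Since min(kappa, M) = kappa - (kappa - M)_+, the function
    phi0 lies in the domain of LM and LM phi0 = lambda0 phi0 + h; moreover
    normHE is the norm of h.  Let r = phi0 - c hphi0, the component of phi0
    orthogonal to hphi0.  Then
        <r, LM r> = lambda0 ||r||^2 + <r, h>,
    while the gap hypothesis gives <r, LM r> >= (lambda0 + delta) ||r||^2.
    Cauchy-Schwarz yields ||r|| <= ||h|| / delta, and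
    ||hphi0 - phi0||^2 = 2 - 2 c = 2 ||r||^2 / (1 + c) is the claim
    ([davis_kahan]).

    The gap hypothesis bounds <f, LM f> below on the complement of some
    unspecified line, spanned by v say.  To move the bound to the complement
    of hphi0 ([gap_orthogonal_eigenfunction]), combine f orthogonal to hphi0
    with hphi0 into a vector orthogonal to v; this works as soon as the
    eigenvalue of hphi0 is below lambda0 + delta.  That eigenvalue is at most
    <phi0, LM phi0> = lambda0 + <phi0, h> <= lambda0, because the bottom of
    the spectrum of a self-adjoint operator bounds its Rayleigh quotients from
    below ([spectral_bottom_rayleigh]).

    The last fact comes from the following maximality argument.  For l below
    the spectrum of S, let R_l be the inverse of S - l, and let a be the
    largest nonpositive number with R_l >= a.  If a < 0, then R_l - a is invertible because l + 1/a is again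
    below the spectrum, and a nonnegative invertible symmetric operator is
    bounded below by a positive constant; so a could be increased
    ([rayleigh_improve]).  Hence a = 0, that is S - l >= 0, for every l below
    the spectrum ([resolvent_rayleigh]). *)

(** * The inner product of L2 *)

Lemma discriminant_le (R : realFieldType) (a b c : R) : 0 <= a -> 0 <= c ->
  (forall t, 0 <= a + 2 * t * b + t ^+ 2 * c) -> b ^+ 2 <= a * c.
Proof.
move=> a0 c0 H; have [c00|cn0] := eqVneq c 0; last first.
  have cp : 0 < c by rewrite lt0r cn0.
  have := H (- b / c).
  have -> : a + 2 * (- b / c) * b + (- b / c) ^+ 2 * c = (a * c - b ^+ 2) / c.
    by field.
  by rewrite pmulr_lge0 ?invr_gt0// subr_ge0.
rewrite c00 mulr0; have [->|b0] := eqVneq b 0; first by rewrite expr0n.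
have := H (- (a + 1) / (2 * b)).
have -> : a + 2 * (- (a + 1) / (2 * b)) * b + (- (a + 1) / (2 * b)) ^+ 2 * c = -1.
  by rewrite c00; field.
by rewrite ler0N1.
Qed.

Section inner_product.
Context {R : realType} {dT : measure_display} {T : measurableType dT}.
Variable mu : {measure set T -> \bar R}.
Implicit Types f g h : L2 mu.

Lemma inner_integrable f g : mu.-integrable setT (EFin \o (f \* g)).
Proof. by apply/Lfun1_integrable/Lfun2_mul_Lfun1; exact: LfunP. Qed.

Lemma innerC f g : inner f g = inner g f.
Proof. by apply: eq_Rintegral => x _; rewrite mulrC. Qed.

Lemma innerDl f g h : inner (f + g) h = inner f h + inner g h.
Proof.
rewrite /inner -RintegralD//; [|exact: inner_integrable..].
by apply: eq_Rintegral => x _; rewrite -mulrDl.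
Qed.

Lemma innerZl a f g : inner (a *: f) g = a * inner f g.
Proof.
rewrite /inner -RintegralZl//; last exact: inner_integrable.
by apply: eq_Rintegral => x _; rewrite mulrA.
Qed.

Lemma innerNl f g : inner (- f) g = - inner f g.
Proof. by rewrite -scaleN1r innerZl mulN1r. Qed.

Lemma innerDr f g h : inner f (g + h) = inner f g + inner f h.
Proof. by rewrite !(innerC f) innerDl. Qed.

Lemma innerZr a f g : inner f (a *: g) = a * inner f g.
Proof. by rewrite !(innerC f) innerZl. Qed.

Lemma innerNr f g : inner f (- g) = - inner f g.
Proof. by rewrite !(innerC f) innerNl. Qed.

Definition innerE := (innerDl, innerDr, innerNl, innerNr, innerZl, innerZr).

Lemma inner_ge0 f : 0 <= inner f f.
Proof. by apply: Rintegral_ge0 => x _; rewrite -expr2 sqr_ge0. Qed.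

(** Elements of L2 are functions, whereas equations between them hold only
    almost everywhere: this is how the latter are used. *)
Lemma eq_ae_inner f g h : f = g %[ae mu] -> inner f h = inner g h.
Proof.
move=> fg; rewrite /inner /Rintegral; congr fine; apply: ae_eq_integral => //.
- by apply: (measurable_int mu); exact: inner_integrable.
- by apply: (measurable_int mu); exact: inner_integrable.
- by apply: filterS fg => x /(_ I) /= ->.
Qed.

Lemma norm2_ge0 f : 0 <= norm2 f.
Proof. by rewrite fine_ge0// Lnorm_ge0. Qed.

Lemma norm2_sqr f : norm2 f ^+ 2 = inner f f.
Proof.
rewrite -powR_mulrn ?norm2_ge0// /norm2 -fine_poweR powR_Lnorm//.
rewrite /inner /Rintegral; congr fine; apply: eq_integral => x _.
by rewrite /= powR_mulrn// real_normK ?num_real.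
Qed.

Lemma eq_ae_norm2 f g : f = g %[ae mu] -> norm2 f = norm2 g.
Proof.
move=> fg; apply/eqP; rewrite -(eqrXn2 (n := 2)) ?norm2_ge0// !norm2_sqr.
by rewrite (eq_ae_inner _ _ _ fg) innerC (eq_ae_inner _ _ _ fg).
Qed.

Lemma norm2Z a f : norm2 (a *: f) = `|a| * norm2 f.
Proof.
apply/eqP; rewrite -(eqrXn2 (n := 2)) ?mulr_ge0 ?norm2_ge0//.
by rewrite exprMn !norm2_sqr !innerE real_normK ?num_real// mulrA -expr2.
Qed.

Lemma norm2N f : norm2 (- f) = norm2 f.
Proof. by rewrite -scaleN1r norm2Z normrN1 mul1r. Qed.

Lemma cauchy_schwarz_inner f g : inner f g <= norm2 f * norm2 g.
Proof.
apply: le_trans (ler_norm _) _.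
rewrite -(ler_pXn2r (n := 2)) ?nnegrE ?mulr_ge0 ?norm2_ge0//.
rewrite real_normK ?num_real// exprMn !norm2_sqr.
apply: discriminant_le; rewrite ?inner_ge0// => t.
have := inner_ge0 (f + t *: g).
rewrite !innerE (innerC g f); congr (_ <= _); ring.
Qed.

End inner_product.

(** * Rayleigh quotients of self-adjoint operators *)

Section selfadjoint.
Context {R : realType} {dT : measure_display} {T : measurableType dT}.
Variable mu : {measure set T -> \bar R}.
Variable S : selfadjoint_operator mu.
Implicit Types f g h k : L2 mu.

Lemma sa_symmetric f g f' g' : S f g -> S f' g' -> inner f g' = inner g f'.
Proof. by move=> /sa_adjoint; exact. Qed.

Lemma sa_lincomb a b f g f' g' :
  S f g -> S f' g' -> S (a *: f + b *: f') (a *: g + b *: g').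
Proof.
move=> Sf Sf'; apply/sa_adjoint => h h' Sh.
by rewrite !innerE (sa_symmetric _ _ _ _ Sf Sh) (sa_symmetric _ _ _ _ Sf' Sh).
Qed.

Lemma sa_scale a f g : S f g -> S (a *: f) (a *: g).
Proof.
by move=> Sf; have := sa_lincomb a 0 _ _ _ _ Sf Sf; rewrite !scale0r !addr0.
Qed.

(** In terms of the bounded operator T = R_l - a, where R_l is the inverse of
    S - l, a vector D = (S - l) g satisfies <T D, D> = <g, D> - a ||D||^2.  As
    l + 1/a is in the resolvent set, D = T D' with ||D'|| bounded by a multiple
    of ||D||, and Cauchy-Schwarz for the nonnegative form of T gives
      ||D||^4 = <T D', D>^2 <= <T D', D'> <T D, D> = <D, D'> <T D, D>
              <= K ||D||^2 <T D, D>,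
    that is <T D, D> >= ||D||^2 / K.  Everything is written with g and g' in
    the domain of S, so R_l itself never appears. *)
Lemma rayleigh_improve (l a : R) :
  a < 0 -> resolvent_set S (l + a^-1) ->
  (forall f h, S f h -> a * norm2 (h - l *: f) ^+ 2 <= inner f (h - l *: f)) ->
  exists2 e : R, 0 < e &
    forall f h, S f h ->
      (a + e) * norm2 (h - l *: f) ^+ 2 <= inner f (h - l *: f).
Proof.
move=> a0 [surj [C bnd]] lb.
have an0 : a != 0 by rewrite lt_eqF.
have C0 : 0 <= `|C| by [].
(* K bounds the norm of the inverse of R_l - a. *)
pose K := (1 + `|C| / - a) / - a.
have K0 : 0 < K.
  by rewrite divr_gt0 ?oppr_gt0// ltr_pwDl// divr_ge0// oppr_ge0 ltW.
exists K^-1; first by rewrite invr_gt0.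
move=> g h Sg.
have [g' [h' [Sg' g'E]]] := surj ((- a^-1) *: (h - l *: g)).
(* D and D' are opaque, so that bilinearity does not expand them. *)
have [D DE] : exists D, D = h - l *: g by exists (h - l *: g).
have [D' DE'] : exists D', D' = h' - l *: g' by exists (h' - l *: g').
have lbD := lb _ _ Sg; have lbD' := lb _ _ Sg'.
rewrite -DE in g'E lbD *; rewrite -DE' in lbD'.
(* (R_l - a) D' = D, tested against k. *)
have TD' k : inner k g' - a * inner k D' = inner k D.
  have := eq_ae_inner _ _ _ k g'E.
  rewrite DE' !(innerC _ k) !innerE => H.
  apply: (mulfI (x := - a^-1)); first by rewrite oppr_eq0 invr_eq0.
  rewrite -H; field.
  done.
have sym : inner g D' = inner D g'.
  by rewrite DE DE' !innerE (sa_symmetric _ _ _ _ Sg Sg').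
(* Cauchy-Schwarz for the form of R_l - a, nonnegative by lb. *)
have CS : (norm2 D ^+ 2) ^+ 2 <=
    (inner g D - a * norm2 D ^+ 2) * (inner g' D' - a * norm2 D' ^+ 2).
  apply: discriminant_le; rewrite ?subr_ge0//.
  move=> t.
  have := lb _ _ (sa_lincomb 1 t _ _ _ _ Sg Sg').
  have -> : 1 *: h + t *: h' - l *: (1 *: g + t *: g') = D + t *: D'.
    rewrite DE DE' !scale1r scalerDr !scalerBr !scalerA opprD (mulrC t l).
    by rewrite addrACA.
  rewrite -subr_ge0 !norm2_sqr scale1r !innerE -(TD' D) sym (innerC _ g' D).
  rewrite (innerC _ D' D).
  congr (_ <= _); ring.
have BD' : inner g' D' - a * norm2 D' ^+ 2 <= K * norm2 D ^+ 2.
  rewrite norm2_sqr (innerC _ g') TD'.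
  have -> : inner D' D = (norm2 D ^+ 2 + - inner D g') / - a.
    rewrite (innerC _ D') norm2_sqr -(TD' D); field.
    done.
  rewrite /K mulrAC ler_pM2r ?invr_gt0 ?oppr_gt0// mulrDl mul1r lerD2l.
  rewrite -innerNl; apply: le_trans (cauchy_schwarz_inner _ _ _) _.
  rewrite norm2N expr2 [leRHS]mulrA mulrC ler_wpM2r ?norm2_ge0//.
  apply: le_trans (bnd _ _ Sg') _.
  rewrite (eq_ae_norm2 _ _ _ g'E) norm2Z normrN normfV ltr0_norm//.
  rewrite mulrA ler_wpM2r ?norm2_ge0// ler_wpM2r ?invr_ge0 ?oppr_ge0 ?(ltW a0)//.
  exact: ler_norm.
have P0 : 0 <= inner g D - a * norm2 D ^+ 2 by rewrite subr_ge0.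
rewrite mulrDl -lerBrDl.
have [D0|Dn0] := eqVneq (norm2 D ^+ 2) 0; first by rewrite D0 !mulr0 in P0 *.
have Dp : 0 < norm2 D ^+ 2 by rewrite lt0r Dn0 sqr_ge0.
rewrite ler_pdivrMl// -(ler_pM2r Dp) -expr2.
apply: le_trans CS _.
by rewrite [leRHS]mulrAC mulrC ler_wpM2r.
Qed.

(** Bounds <R_l f, f> >= a ||f||^2 with a <= 0 exist because R_l is bounded; a
    maximal one must have a = 0, for otherwise [rayleigh_improve] applies.
    This gives S - l >= 0 for l < m, and l tends to m. *)
Lemma resolvent_rayleigh (m : R) : (forall l, l < m -> resolvent_set S l) ->
  forall f h, S f h -> m * inner f f <= inner f h.
Proof.
move=> res.
suff H l : l < m -> forall f h, S f h -> 0 <= inner f (h - l *: f).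
  move=> f h Sf; apply/ler_addgt0Pr => e e0.
  have [f0|fn0] := eqVneq (inner f f) 0.
    have m1 : m - 1 < m by lra.
    by have := H _ m1 _ _ Sf; rewrite !innerE f0 !mulr0 subr0; lra.
  have fp : 0 < inner f f by rewrite lt0r fn0 inner_ge0.
  have := H (m - e / inner f f) _ f h Sf.
  rewrite ltrBlDr ltrDl divr_gt0// => /(_ isT).
  rewrite !innerE mulrBl divfK//; lra.
move=> lm.
have [surj [C bnd]] := res _ lm.
pose lb (a : R) := forall f h, S f h ->
  a * norm2 (h - l *: f) ^+ 2 <= inner f (h - l *: f).
pose E := [set a : R | a <= 0 /\ lb a].
have E0 : E !=set0.
  (* ||g|| <= C ||(S - l) g|| and Cauchy-Schwarz *)
  exists (- `|C|); split; first by rewrite oppr_le0.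
  move=> f h Sf; rewrite mulNr lerNl -innerNl.
  apply: le_trans (cauchy_schwarz_inner _ _ _) _.
  rewrite norm2N expr2 mulrA ler_wpM2r ?norm2_ge0//.
  by apply: le_trans (bnd _ _ Sf) _; rewrite ler_wpM2r ?norm2_ge0 ?ler_norm.
have supE : has_sup E by split => //; exists 0 => a [].
(* The supremum is attained: each inequality is closed in a. *)
have lbs : lb (sup E).
  move=> f h Sf; have [N0|Nn0] := eqVneq (norm2 (h - l *: f) ^+ 2) 0.
    have [a [_ /(_ _ _ Sf)]] := E0; by rewrite N0 !mulr0.
  have Np : 0 < norm2 (h - l *: f) ^+ 2 by rewrite lt0r Nn0 sqr_ge0.
  rewrite -ler_pdivlMr//; apply: ge_sup => // a [_ /(_ _ _ Sf)].
  by rewrite ler_pdivlMr.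
have := ge_sup E0 (x := 0) (fun _ => @proj1 _ _).
rewrite le_eqVlt => /predU1P[s0|s0].
  by move=> f h Sf; have := lbs _ _ Sf; rewrite s0 mul0r.
have [|e e0 lbe] := rayleigh_improve l _ s0 _ lbs.
  by apply: res; rewrite (lt_trans _ lm)// gtrDl invr_lt0.
have : Num.min (sup E + e) 0 <= sup E.
  apply: (ub_le_sup supE.2); split; first by rewrite ge_min lexx orbT.
  move=> f h Sf; apply: le_trans (lbe _ _ Sf).
  by rewrite ler_wpM2r ?sqr_ge0// ge_min lexx.
by rewrite leNgt lt_min s0 ltrDl e0.
Qed.

(** The part of the variational characterization of the bottom of the
    spectrum that is usually read off the spectral theorem. *)
Lemma spectral_bottom_rayleigh (m : R) f h : (m%:E <= spectral_bottom S)%E ->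
  S f h -> m * inner f f <= inner f h.
Proof.
move=> mS; apply: resolvent_rayleigh => l lm; apply: contrapT => sl.
have : (spectral_bottom S <= l%:E)%E by apply: ereal_inf_lbound; exists l.
by move=> /(le_trans mS); rewrite lee_fin leNgt lm.
Qed.

(** The complement of a low eigenfunction q is an optimal choice in the
    max-min problem: a vector f orthogonal to q with Rayleigh quotient below s
    would span with q a plane on which the form of S - s is negative, and that
    plane contains a nonzero vector orthogonal to v, whatever v is. *)
Lemma gap_orthogonal_eigenfunction (s m : R) (q f g : L2 mu) :
  (s%:E < second_variational_value S)%E ->
  m < s -> norm2 q = 1 -> S q (m *: q) -> S f g -> inner f q = 0 ->
  s * inner f f <= inner f g.
Proof.
move=> sgap ms q1 Sq Sf fq.
have [_ [V [v vn0 ->] <-] sV] := ereal_sup_gt sgap.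
(* The bound on unit vectors, made homogeneous. *)
have V_le k k' : S k k' -> inner k v = 0 -> s * inner k k <= inner k k'.
  move=> Sk kv; have [k0|kn0] := eqVneq (norm2 k) 0.
    rewrite -norm2_sqr k0 expr0n mulr0.
    have := cauchy_schwarz_inner _ (- k) k'.
    by rewrite norm2N k0 mul0r innerNl oppr_le0.
  have : (s%:E <= (inner ((norm2 k)^-1 *: k) ((norm2 k)^-1 *: k'))%:E)%E.
    apply: (le_trans (ltW sV)); apply: ereal_inf_lbound.
    exists ((norm2 k)^-1 *: k), ((norm2 k)^-1 *: k'); split => //.
    - move=> h [a /eq_ae_inner hE].
      by rewrite innerC hE innerZl innerC innerZl kv !mulr0.
    - by rewrite norm2Z normfV ger0_norm ?norm2_ge0// mulVf.
    - exact: sa_scale.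
  rewrite lee_fin !innerE mulrA -expr2 exprVn norm2_sqr mulrC ler_pdivlMr//.
  by rewrite -norm2_sqr exprn_gt0// lt0r kn0 norm2_ge0.
have [qv|qv] := eqVneq (inner q v) 0; last first.
  (* <f, v> q - <q, v> f is orthogonal to v. *)
  have := V_le _ _ (sa_lincomb (inner f v) (- inner q v) _ _ _ _ Sq Sf) _.
  have qg : inner q g = 0.
    by rewrite (sa_symmetric _ _ _ _ Sq Sf) innerZl innerC fq mulr0.
  rewrite !innerE fq (innerC _ q f) fq qg -!norm2_sqr q1 => /(_ _) H.
  have {H} := H ltac:(ring).
  set x := inner f g; set N := norm2 f ^+ 2; set a := inner f v; set b := inner q v.
  move=> H; have b2 : 0 < b ^+ 2 by rewrite exprn_even_gt0.
  rewrite -(ler_pM2l b2).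
  have a2 : 0 <= (s - m) * a ^+ 2 by rewrite mulr_ge0 ?sqr_ge0// subr_ge0 ltW.
  nra.
(* Here q itself is orthogonal to v, which contradicts m < s. *)
have := V_le _ _ Sq qv; rewrite innerZr -norm2_sqr q1 expr1n !mulr1 => sm.
by move: ms; rewrite ltNge sm.
Qed.

End selfadjoint.

(** * Perturbation of the ground state *)

Section davis_kahan.
Context {R : realType} {dT : measure_display} {T : measurableType dT}.
Variable mu : {measure set T -> \bar R}.

(** Here p is an approximate eigenvector of S with residual h, and r is its
    component orthogonal to the exact eigenvector q.  As S r - l r is h up to a
    multiple of q, only <r, h> enters <r, (S - l) r> >= delta ||r||^2. *)
Lemma davis_kahan (S : selfadjoint_operator mu) (l m delta : R)
    (p q h : L2 mu) :
  0 < delta -> ((l + delta)%:E < second_variational_value S)%E ->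
  m < l + delta -> norm2 p = 1 -> norm2 q = 1 ->
  S p (l *: p + h) -> S q (m *: q) -> 0 <= inner p q ->
  norm2 (q - p) <=
    Num.sqrt 2 / Num.sqrt (1 + inner p q) * (norm2 h / delta).
Proof.
move=> delta0 gap mlt p1 q1 Sp Sq c0.
have pp : inner p p = 1 by rewrite -norm2_sqr p1 expr1n.
have qq : inner q q = 1 by rewrite -norm2_sqr q1 expr1n.
have qp : inner q p = inner p q by rewrite innerC.
set c := inner p q in c0 qp *.
have [r rE] : exists r, r = 1 *: p + (- c) *: q by eexists.
have rq : inner r q = 0 by rewrite rE !innerE qq -/c; ring.
have rp : inner r p = 1 - c ^+ 2 by rewrite rE !innerE pp qp; ring.
have rr : inner r r = 1 - c ^+ 2.
  by rewrite {2}rE innerDr !innerZr rq rp; ring.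
have r_le : norm2 r <= norm2 h / delta.
  have [->|rn0] := eqVneq (norm2 r) 0.
    by rewrite divr_ge0 ?norm2_ge0// ltW.
  have rp0 : 0 < norm2 r by rewrite lt0r rn0 norm2_ge0.
  rewrite ler_pdivlMr// -(ler_pM2l rp0).
  apply: le_trans (cauchy_schwarz_inner _ r h).
  have Sr := sa_lincomb _ _ 1 (- c) _ _ _ _ Sp Sq.
  rewrite -rE in Sr.
  have := gap_orthogonal_eigenfunction _ _ _ _ _ _ _ gap mlt q1 Sq Sr rq.
  rewrite !innerDr !innerZr innerDr innerZr rq rp -rr -norm2_sqr; lra.
have qpE : norm2 (q - p) = Num.sqrt 2 / Num.sqrt (1 + c) * norm2 r.
  have c10 : 1 + c != 0 by rewrite gt_eqF// ltr_pwDl.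
  apply/eqP; rewrite -(eqrXn2 (n := 2)) ?mulr_ge0 ?invr_ge0 ?norm2_ge0//.
  rewrite !exprMn exprVn !sqr_sqrtr ?addr_ge0// !norm2_sqr rr !innerE pp qq qp -/c.
  apply/eqP; field.
  done.
by rewrite qpE ler_wpM2l// divr_ge0.
Qed.

Lemma le_Lfun2 (f k : T -> R) : measurable_fun setT f -> k \in Lfun mu 2%:E ->
  (forall x, `|f x| <= `|k x|) -> f \in Lfun mu 2%:E.
Proof.
move=> mf k2 fk.
have mk : measurable_fun setT k by move: k2 => /sub_Lfun_mfun; rewrite inE.
have mpow (u : T -> R) : measurable_fun setT u ->
    measurable_fun setT (fun x => (`|u x| `^ 2)%:E).
  move=> mu'; apply/measurable_EFinP.
  apply: (@measurableT_comp _ _ _ _ _ _ (@powR R ^~ 2)) => //.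
  exact: measurableT_comp.
rewrite inE; apply/andP; split; rewrite inE//= /finite_norm unlock poweR_lty//.
have /integrable_lty := Lfun_integrable (ler1n _ 2) k2.
move=> /(_ measurableT); apply: le_lt_trans.
apply: ge0_le_integral => //.
- by move=> x _; rewrite poweR_ge0.
- exact: mpow.
- exact: mpow.
move=> x _ /=.
by rewrite lee_fin ge0_ler_powR ?nnegrE.
Qed.

(** For a vector f, the map theta |-> m (theta f) has norm ||m f||; the
    set defining the operator norm is bounded by ||m f|| and contains it, at
    theta = 1. *)
Lemma norm2_le_operator_norm (m : T -> R) (f g : L2 mu) :
  multiplication m f g ->
  norm2 g <= operator_norm (fun theta => multiplication m (theta *: f)).
Proof.
move=> mfg; apply: ub_le_sup.
  exists (norm2 g) => _ [k [theta theta1 mk] <-].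
  have -> : norm2 k = norm2 (theta *: g).
    apply: eq_ae_norm2; apply: filterS2 mk mfg => x /(_ I) + /(_ I) + _ => /= ->.
    by move=> gE; rewrite /GRing.scale/= gE mulrCA.
  by rewrite norm2Z ler_piMl ?norm2_ge0.
by exists g => //; exists 1; rewrite ?normr1// scale1r.
Qed.

End davis_kahan.

Theorem theorem3p4 (R : realType) (d : nat) (d_gt0 : (0 < d)%N)
    (A : {mfun 'rV[R]_d >-> R}) (A_smooth : smooth A)
    (A_sde : langevin_well_posed A)
    (kappa : 'rV[R]_d -> R)
    (kappa_meas : measurable_fun [set: 'rV[R]_d] kappa)
    (kappa_bnd : locally_bounded kappa)
    (kappa_ge0 : forall x, 0 <= kappa x)
    (kappa_infty : tends_to_infinity kappa)
    (Lkappa : selfadjoint_operator (Gamma A))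
    (Lkappa_gen : forall f g, Lkappa f g <-> generator kappa f g)
    (lambda0 : R) (phi0 : L2 (Gamma A))
    (lambda0_bottom : lambda0%:E = spectral_bottom Lkappa)
    (phi0_eigen : eigenfunction Lkappa lambda0 phi0)
    (phi0_norm : norm2 phi0 = 1)
    (phi0_pos : {ae Gamma A, forall x, 0 < phi0 x})
    (kappa_phi0 : (fun x => kappa x * phi0 x) \in Lfun (Gamma A) 2%:E)
    (M : R) (M_ge0 : 0 <= M) (M_ge : lambda0 <= M)
    (LM : selfadjoint_operator (Gamma A))
    (LM_gen : forall f g,
       LM f g <-> generator (fun x => Num.min (kappa x) M) f g)
    (delta : R) (delta_gt0 : 0 < delta)
    (gap : ((lambda0 + delta)%:E < second_variational_value LM)%E)
    (hlambda0 : R) (hphi0 : L2 (Gamma A))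
    (hlambda0_bottom : hlambda0%:E = spectral_bottom LM)
    (hphi0_eigen : eigenfunction LM hlambda0 hphi0)
    (hphi0_norm : norm2 hphi0 = 1)
    (phi0_hphi0 : 0 <= inner phi0 hphi0) :
  let HM : L2 (Gamma A) -> L2 (Gamma A) -> Prop :=
    multiplication (fun x => - Num.max (kappa x - M) 0) in
  let E0 : R -> L2 (Gamma A) := fun theta => theta *: phi0 in
  let normHE := operator_norm (fun theta g => HM (E0 theta) g) in
  norm2 (hphi0 - phi0) <=
    Num.sqrt 2 / Num.sqrt (1 + inner phi0 hphi0) * (normHE / delta) /\
  Num.sqrt 2 / Num.sqrt (1 + inner phi0 hphi0) * (normHE / delta) <=
    Num.sqrt 2 * normHE / delta.
Proof.
move=> HM E0 normHE.
pose excess x : R := - Num.max (kappa x - M) 0.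
have mexcess : measurable_fun setT excess.
  apply: measurableT_comp => //; apply: measurable_maxr => //.
  exact: measurable_funB.
(* 0 <= (kappa - M)_+ <= kappa, as M and kappa are nonnegative. *)
have h2 : (fun x => excess x * phi0 x) \in Lfun (Gamma A) 2%:E.
  apply: le_Lfun2 kappa_phi0 _; first exact: measurable_funM.
  move=> x; rewrite !normrM ler_wpM2r// normrN.
  rewrite (ger0_norm (kappa_ge0 x)) ger0_norm ?le_max ?lexx ?orbT//.
  by rewrite ge_max kappa_ge0 gerBl M_ge0.
pose h : L2 (Gamma A) := Lfun_Sub (lee1n 2) h2.
have hE : HM phi0 h by apply/nearW.
(* The weak derivatives u, w of phi0 serve for both generators. *)
have LMphi0 : LM phi0 (lambda0 *: phi0 + h).
  apply/LM_gen.
  have /Lkappa_gen[u [w [Hu Hw gE]]] := phi0_eigen.2.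
  exists u, w; split => //.
  apply: filterS gE => x /(_ I) /(congr1 (+%R^~ (excess x * phi0 x))) gE _.
  apply: (eq_trans gE) => /=; rewrite -addrA; congr (_ + _).
  rewrite -mulrDl; congr (_ * _); rewrite /excess.
  by case: (leP (kappa x) M) => ?; case: leP => ?; lra.
have hneg : inner phi0 h <= 0.
  rewrite -oppr_ge0 -innerNr; apply: Rintegral_ge0 => x _.
  change (0 <= phi0 x * - (excess x * phi0 x)).
  rewrite /excess mulNr opprK mulrCA mulr_ge0 ?le_max ?lexx ?orbT//.
  by rewrite -expr2 sqr_ge0.
have hl_le : hlambda0 <= lambda0.
  have := spectral_bottom_rayleigh _ LM hlambda0 _ _ _ LMphi0.
  rewrite hlambda0_bottom lexx => /(_ isT).
  rewrite innerDr innerZr -norm2_sqr phi0_norm expr1n; lra.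
have hnorm : norm2 h <= normHE by exact: norm2_le_operator_norm.
have norm0 : 0 <= normHE by exact: le_trans (norm2_ge0 _ _) hnorm.
split.
  apply: (le_trans (davis_kahan _ LM lambda0 hlambda0 delta _ _ h _ _ _ _ _ _ _ _)) => //.
  - by rewrite (le_lt_trans hl_le)// ltrDl.
  - exact: hphi0_eigen.2.
  - by rewrite ler_wpM2l ?divr_ge0// ler_wpM2r// invr_ge0 ltW.
rewrite mulrA; apply: ler_wpM2r; first by rewrite invr_ge0 ltW.
rewrite ler_wpM2r// ler_piMr// invf_le1 ?sqrtr_gt0 ?ltr_pwDl//.
by rewrite -[leLHS]sqrtr1 ler_wsqrtr// lerDl.
Qed.
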